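(* Let $d\ge 2$, and let the scale sequence $\{S_j\}$ and the weight functions $\{b_j\}$ satisfy the conditions listed in the context. For $j\ge 1$ let $\Psi_j(\cos\theta)=\sum_{\ell\ge 0} b_j(\ell)\,Z_{\ell;d}(\cos\theta)$. Then for every $M\in\mathbb{N}$ with $M>d$ there exists a constant $C_M>0$, independent of $j$ and of $\theta$, such that for all sufficiently large $j$ and all $\theta\in(0,\pi]$, $$\left|\Psi_j(\cos\theta)\right|\le C_M\,\bigl(S_{j+1}^{d}-S_{j-1}^{d}\bigr)\max\left\{\frac{1}{S_{j-1}^{2M}\theta^{2M}},\ \frac{1}{(S_j-S_{j-1})^{2M}\theta^{2M}}\right\}.$$
   Context: Kernel. For $d\ge2$ put $\eta_d=(d-1)/2$ and $\omega_d=\frac{2\pi^{(d+1)/2}}{\Gamma((d+1)/2)}$. For $\ell\ge0$ and $t\in[-1,1]$, $Z_{\ell;d}(t)=\frac{\ell+\eta_d}{\eta_d\,\omega_d}\,G_\ell^{(\eta_d)}(t)$, where $G_\ell^{(\eta_d)}$ is the Gegenbauer polynomial of degree $\ell$ and parameter $\eta_d$. On the unit sphere $\mathbb{S}^d\subset\mathbb{R}^{d+1}$ one writes $\Psi_j(x,y)=\Psi_j(\langle x,y\rangle)=\Psi_j(\cos\theta)$ with $\theta=\arccos\langle x,y\rangle$. Scale sequence. $\{S_j\}_{j\ge0}$ is a strictly increasing sequence of real numbers with $S_0=1$ and $S_j-S_{j-1}\le S_{j+1}-S_j$ for all $j\ge 1$. Weight functions. $\{b_j\}_{j\ge0}$ is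 a sequence of real-valued $C^\infty$ functions on $[0,\infty)$ such that (conditions involving $S_{j-1}$ being read for $j\ge1$): 1. for every $n\in\mathbb{N}$ there is a constant $K(n)$, not depending on $j$, such that for all $j$ and all $u$, $|D^{(n)}b_j(u)|\le K(n)\,(S_j-S_{j-1})^{-n}$, where $D^{(n)}$ denotes the $n$-th derivative; 2. $b_j$ has compact support contained in $\Lambda_j=[S_{j-1},S_{j+1}]$, with $b_j(S_{j-1})=b_j(S_{j+1})=0$ and $b_j(S_j)=1$; 3. (partition of unity) $\sum_{j\ge0}b_j^2(u)=1$ for all $u\ge1$. *)

(* Defs.v *)
From HB Require Import structures.
From mathcomp Require Import all_boot all_order all_algebra.
From mathcomp Require Import all_classical all_reals all_analysis.

Set Implicit Arguments.
Unset Strict Implicit.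
Unset Printing Implicit Defensive.

Import Order.TTheory GRing.Theory Num.Theory.
Import numFieldNormedType.Exports.

Local Open Scope classical_set_scope.
Local Open Scope ring_scope.

Section Kernel.
Context {R : realType}.
Implicit Types (a t z : R) (d l n : nat).

(* Gegenbauer polynomials through the three-term recurrence
     n G_n = 2 (n + a - 1) X G_(n-1) - (n + 2 a - 2) G_(n-2),
   with n = m.+2 below, and G_0 = 1, G_1 = 2 a X. *)
Fixpoint gegenbauer a n : {poly R} :=
  match n with
  | 0 => 1
  | 1 => (2 * a) *: 'X
  | (m.+1 as p).+1 =>
      m.+2%:R^-1 *: ((2 * (m.+1%:R + a)) *: ('X * gegenbauer a p)
                     - (m%:R + 2 * a) *: gegenbauer a m)
  end.

Definition Gamma z : R :=
  (\int[lebesgue_measure]_(x in `]0%R, +oo[) (x `^ (z - 1) * expR (- x)))%R.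

Definition eta d : R := (d%:R - 1) / 2.

Definition omega d : R :=
  2 * pi `^ ((d%:R + 1) / 2) / Gamma ((d%:R + 1) / 2).

Definition Z d l t : R :=
  (l%:R + eta d) / (eta d * omega d) * (gegenbauer (eta d) l).[t].

Definition Psi d (b : nat -> R -> R) (j : nat) t : R :=
  limn (series (fun l => b j l%:R * Z d l t)).

End Kernel.

Section HalfLine.
Context {R : realType}.
Implicit Types (f : R -> R) (x : R) (n : nat).

(* A function on [0, +oo[ is a function on R whose values at negative reals
   are irrelevant: difference quotients only use increments h != 0 with
   0 <= x + h, so that the derivative at 0 is the right derivative. *)
Definition diff_quot_ge0 f x : set_system R :=
  (h^-1 * (f (x + h) - f x)) @[h --> within [set h | 0 <= x + h] 0^'].

Definition derive_ge0 f x : R := lim (diff_quot_ge0 f x).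

Definition derive_ge0n n f : R -> R := iter n derive_ge0 f.

Definition smooth_ge0 f : Prop :=
  forall n x, 0 <= x -> cvg (diff_quot_ge0 (derive_ge0n n f) x).

Definition supp_ge0 f : set R := closure [set u | 0 <= u /\ f u != 0].

End HalfLine.

Record scale_sequence (R : realType) (S : nat -> R) : Prop := ScaleSequence {
  scale_incr : forall i j, (i < j)%N -> S i < S j;
  scale0 : S 0%N = 1;
  scale_gap : forall j, (0 < j)%N -> S j - S j.-1 <= S j.+1 - S j
}.

Record weight_functions (R : realType) (S : nat -> R) (b : nat -> R -> R) :
    Prop := WeightFunctions {
  weight_smooth : forall j, smooth_ge0 (b j);
  weight_derive : forall n, exists K : R, forall j u, (0 < j)%N -> 0 <= u ->
    `|derive_ge0n n (b j) u| <= K * (S j - S j.-1) ^- n;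
  weight_compact : forall j, (0 < j)%N -> compact (supp_ge0 (b j));
  weight_supp : forall j, (0 < j)%N -> supp_ge0 (b j) `<=` `[S j.-1, S j.+1];
  weight_left : forall j, (0 < j)%N -> b j (S j.-1) = 0;
  weight_right : forall j, b j (S j.+1) = 0;
  weight_peak : forall j, b j (S j) = 1;
  weight_unity : forall u, 1 <= u ->
    series (fun j => b j u ^+ 2) @ \oo --> (1 : R)
}.

(* Main.v *)
Require Import Defs.
From HB Require Import structures.
From mathcomp Require Import all_boot all_order all_algebra.
From mathcomp Require Import all_classical all_reals all_analysis.
From mathcomp Require Import ring lra zify.

(** Multiplying [\sum_l f_l (l + a) G_l(t)] by [1 - t] and using the three-term
    recurrence replaces [f] by [-1/2] times its second difference plus
    [a / (l + a)] times a central difference. Each application gains a factor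
    [r^2], where [r = max(1/S_(j-1), 1/(S_j - S_(j-1)))], because the derivative
    bounds on [b_j] bound its finite differences by the mean value theorem.
    After [M] applications, [(1 - cos theta)^M Psi_j] is a sum of at most a
    constant times [S_(j+1) - S_(j-1)] terms, each at most a constant times
    [r^(2M) S_(j+1)^(d-1)] since [|G_l| <= (l + 1)^(d-2)] on [[-1, 1]], and
    [1 - cos theta >= theta^2 / 32]. *)

Set Implicit Arguments.
Unset Strict Implicit.
Unset Printing Implicit Defensive.

Import Order.TTheory GRing.Theory Num.Theory.
Import numFieldNormedType.Exports.

Local Open Scope classical_set_scope.
Local Open Scope ring_scope.

(** * Gegenbauer polynomials: size on [[-1, 1]] and multiplication of sums by [1 - t] *)

Section Gegenbauer.
Context {R : realType}.
Implicit Types (a t : R) (f : nat -> R).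

Lemma gegenbauerSS a n t :
  n.+2%:R * (gegenbauer a n.+2).[t] =
  2 * (n.+1%:R + a) * (t * (gegenbauer a n.+1).[t])
  - (n%:R + 2 * a) * (gegenbauer a n).[t].
Proof.
rewrite [gegenbauer a n.+2]/= hornerZ mulrA divff ?pnatr_eq0// mul1r.
by rewrite hornerD hornerN !hornerZ mulrC hornerM hornerX mulrC.
Qed.

(** Bernoulli's inequality [1 + k / m <= (1 + 1 / m)^k], cleared of denominators. It pays for the
    growth of the rotated vector from one index to the next. *)
Lemma expn_bernoulli m k : ((m + k) * m ^ k <= m * m.+1 ^ k)%N.
Proof.
elim: k => [|k IHk]; first by rewrite addn0 !expn0.
have : ((m + k) * m ^ k * m.+1 <= m * m.+1 ^ k * m.+1)%N by rewrite leq_mul2r IHk orbT.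
rewrite !expnS; set p := (m ^ k)%N; set q := (_ ^ k)%N; nia.
Qed.

(* With [a = eta k.+2] and [x = n G_n / 2], the pair [(x + a G_n, y)] is rotated
   by [theta] at each step of the recurrence. *)
Lemma gegenbauer_rotation k n (theta : R) :
  let a : R := Defs.eta k.+2 in let G m := (gegenbauer a m).[cos theta] in
  exists y : R, [/\
    n.+1%:R * G n.+1 / 2 = cos theta * (n%:R * G n / 2 + a * G n) - sin theta * y,
    (n%:R * G n / 2) ^+ 2 + y ^+ 2 <= (n%:R / 2 * n.+1%:R ^+ k) ^+ 2
    & `|G n| <= n.+1%:R ^+ k].
Proof.
move=> a G; have aE : a = k.+1%:R / 2 by rewrite /a /Defs.eta -natr1 addrK.
have cs := cos2Dsin2 theta.
elim: n => [|n [y [rec sq le]]].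
  exists 0; rewrite /G /= !hornerE/=; split.
  - by field.
  - lra.
  - by rewrite normr1 expr1n.
pose X := n%:R * G n / 2 + a * G n.
have bern : (n%:R + 2 * a) * n.+1%:R ^+ k <= n.+1%:R * n.+2%:R ^+ k :> R.
  have := expn_bernoulli n.+1 k; rewrite -(ler_nat R) !natrM !natrX.
  suff -> : n%:R + 2 * a = (n.+1 + k)%:R by [].
  by rewrite aE natrD -!natr1; field.
(* With [B = n.+1%:R ^+ k], passing from [n G_n / 2] to [X] adds
   [(n a + a^2) G_n^2 <= (n a + a^2) B^2] to the square, which completes [(n B / 2)^2] to
   [((n + 2 a) B / 2)^2]; [bern] does the rest. *)
have sqX : X ^+ 2 + y ^+ 2 <= (n.+1%:R / 2 * n.+2%:R ^+ k) ^+ 2.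
  have a0 : 0 <= a by rewrite aE divr_ge0.
  apply: (@le_trans _ _ (((n%:R + 2 * a) / 2 * n.+1%:R ^+ k) ^+ 2)).
    have : G n ^+ 2 <= (n.+1%:R ^+ k) ^+ 2.
      by rewrite -[G n ^+ 2]real_normK ?num_real// ler_sqr ?nnegrE// exprn_ge0.
    move: sq; rewrite /X; set B := _ ^+ k; move: (G n) => g sq gB.
    have n0 : 0 <= n%:R * a + a ^+ 2 by rewrite addr_ge0 ?mulr_ge0 ?exprn_ge0.
    have := ler_wpM2l n0 gB; nra.
  have ge0 : 0 <= (n%:R + 2 * a) / 2 * n.+1%:R ^+ k.
    by rewrite mulr_ge0 ?exprn_ge0 ?divr_ge0 ?addr_ge0 ?mulr_ge0.
  suff le12 : (n%:R + 2 * a) / 2 * n.+1%:R ^+ k <= n.+1%:R / 2 * n.+2%:R ^+ k.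
    by rewrite ler_sqr ?nnegrE// (le_trans ge0).
  by rewrite ![_ / 2]mulrC -!mulrA ler_pM2l ?invr_gt0.
(* Second coordinate of [(X, y)] rotated by [theta]; by [rec] the first one is
   [n.+1%:R * G n.+1 / 2]. *)
exists (sin theta * X + cos theta * y).
have rot : (n.+1%:R * G n.+1 / 2) ^+ 2 + (sin theta * X + cos theta * y) ^+ 2
    = X ^+ 2 + y ^+ 2.
  rewrite rec -/X; transitivity ((cos theta ^+ 2 + sin theta ^+ 2) * (X ^+ 2 + y ^+ 2)).
    by ring.
  by rewrite cs mul1r.
(* Rotating back recovers [X], the term that the halved three-term recurrence subtracts. *)
have XE : cos theta * (n.+1%:R * G n.+1 / 2) + sin theta * (sin theta * X + cos theta * y) = X.
  rewrite rec -/X; transitivity ((cos theta ^+ 2 + sin theta ^+ 2) * X); first by ring.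
  by rewrite cs mul1r.
split.
- rewrite /G gegenbauerSS -/(G n.+1) -/(G n).
  have : X = n%:R * G n / 2 + a * G n by [].
  rewrite -{1}XE => e; move: e; move: (G n.+1) (G n) (sin theta) (cos theta) => g1 g s c e.
  lra.
- by rewrite rot.
- have : (n.+1%:R * G n.+1 / 2) ^+ 2 <= (n.+1%:R / 2 * n.+2%:R ^+ k) ^+ 2.
    apply: le_trans sqX; rewrite -rot lerDl; exact: sqr_ge0.
  rewrite -(@ler_sqrt R) ?sqr_ge0// !sqrtr_sqr mulrAC normrM.
  rewrite [X in _ <= X]ger0_norm ?mulr_ge0 ?exprn_ge0 ?divr_ge0//.
  by rewrite ger0_norm ?divr_ge0// ler_pM2l// divr_gt0.
Qed.

Lemma gegenbauer_le k n (theta : R) :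
  `|(gegenbauer (Defs.eta k.+2) n).[cos theta]| <= n.+1%:R ^+ k.
Proof. by have [y []] := gegenbauer_rotation k n theta. Qed.

(* The action on the coefficients [f] of multiplying
   [\sum_l f l * (l + a) * gegenbauer a l] by [1 - X]. *)
Definition step a f : nat -> R := fun l =>
  f l - (l%:R * f l.-1 + (l%:R + 2 * a) * f l.+1) / (2 * (l%:R + a)).

Definition gsum a t f n :=
  \sum_(0 <= l < n) f l * ((l%:R + a) * (gegenbauer a l).[t]).

(** The recurrence reads [2 t (l + a) G_l = (l + 1) G_(l+1) + (l - 1 + 2 a) G_(l-1)]. Collecting the
    coefficients of each [G_l] yields [step], and the cutoff leaves two boundary terms. At [l = 0]
    the factor [l%:R] kills the default value [f l.-1]. *)
Lemma gsum_stepE a t f n : 0 < a ->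
  2 * (1 - t) * gsum a t f n.+1 = 2 * gsum a t (step a f) n.+1
    - (n.+1%:R * f n * (gegenbauer a n.+1).[t]
       - (n%:R + 2 * a) * f n.+1 * (gegenbauer a n).[t]).
Proof.
move=> a0; rewrite /gsum.
have stepE l g : step a f l * ((l%:R + a) * g) =
    (f l * (l%:R + a) - (l%:R * f l.-1 + (l%:R + 2 * a) * f l.+1) / 2) * g.
  have ? : l%:R + a != 0 by rewrite gt_eqF// ltr_wpDl.
  by rewrite /step; field.
elim: n => [|n IHn].
  by rewrite !big_nat1 stepE /= !hornerE/=; field.
rewrite big_nat_recr//= mulrDr IHn [in RHS]big_nat_recr//= stepE /=.
have e := gegenbauerSS a n t.
have -> : n.+2%:R * f n.+1 * (gegenbauer a n.+2).[t] =
  f n.+1 * (n.+2%:R * (gegenbauer a n.+2).[t]) by ring.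
by rewrite e; field.
Qed.

(** Each [step] moves the end of the support right by at most one index, so the boundary terms at
    [n] vanish throughout the [M] steps. *)
Lemma gsum_iter_step a t f N M n : 0 < a ->
  (forall l, (N <= l)%N -> f l = 0) -> (N + M <= n)%N ->
  (1 - t) ^+ M * gsum a t f n.+1 = gsum a t (iter M (step a) f) n.+1.
Proof.
move=> a0; elim: M N f => [|M IHM] N f f0 Nn; first by rewrite mul1r.
rewrite iterSr -(IHM N.+1) ?addSnnS//; last first.
  case=> // l Nl; rewrite /step/= !f0 ?subrr ?mulr0 ?addr0 ?mul0r ?subr0//; lia.
rewrite exprSr -mulrA; congr (_ * _).
have := gsum_stepE t f n a0; rewrite !f0 ?mulr0 ?mul0r ?subrr ?subr0; try lia.
by rewrite -mulrA => /(mulfI _) -> //; rewrite pnatr_eq0.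
Qed.

Lemma iter_step_low a f L M l : (forall i, (i < L)%N -> f i = 0) ->
  (l + M < L)%N -> iter M (step a) f l = 0.
Proof.
elim: M L f => [|M IHM] L f f0 lL; first by apply: f0; rewrite addn0 in lL.
rewrite iterSr (IHM L.-1)//; last lia.
move=> i iL; rewrite /step !f0 ?mulr0 ?addr0 ?mul0r ?subr0//; lia.
Qed.

End Gegenbauer.

(** * Finite differences and the gain of [r ^+ 2] per step *)

Section FiniteDifferences.
Context {R : realType}.
Implicit Types (f g : nat -> R) (r A B : R).

Definition fdiff f : nat -> R := fun l => f l.+1 - f l.

(** Discrete symbol estimate: amplitude [A], and one factor [r], an inverse length, per
    difference. *)
Definition dbound r n A f := forall m l, (m <= n)%N ->
  `|iter m fdiff f l| <= A * r ^+ m.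

Lemma fdiffD f g : fdiff (f \+ g) = fdiff f \+ fdiff g.
Proof. by apply/funext => l; rewrite /fdiff /=; ring. Qed.

Lemma iter_fdiffD m f g l :
  iter m fdiff (f \+ g) l = iter m fdiff f l + iter m fdiff g l.
Proof. by elim: m f g => // m IHm f g; rewrite !iterSr fdiffD IHm. Qed.

Lemma iter_fdiffZ m c f l :
  iter m fdiff (fun i => c * f i) l = c * iter m fdiff f l.
Proof.
elim: m f => // m IHm f; rewrite !iterSr -IHm; congr (iter m _ _ l).
by apply/funext => i; rewrite /fdiff; ring.
Qed.

Lemma iter_fdiffS m f l : iter m fdiff (fun i => f i.+1) l = iter m fdiff f l.+1.
Proof. by elim: m l => // m IHm l; rewrite !iterS /fdiff !IHm. Qed.

Lemma dboundD r n A B f g : dbound r n A f -> dbound r n B g ->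
  dbound r n (A + B) (f \+ g).
Proof.
move=> fA gB m l mn; rewrite iter_fdiffD mulrDl (le_trans (ler_normD _ _))//.
by rewrite lerD ?fA ?gB.
Qed.

Lemma dboundZ r n A c f : dbound r n A f ->
  dbound r n (`|c| * A) (fun i => c * f i).
Proof. by move=> fA m l mn; rewrite iter_fdiffZ normrM -mulrA ler_wpM2l ?fA. Qed.

Lemma dboundS r n A f : dbound r n A f -> dbound r n A (fun i => f i.+1).
Proof. by move=> fA m l mn; rewrite iter_fdiffS fA. Qed.

Lemma dbound_fdiff r n A f : dbound r n.+1 A f -> dbound r n (A * r) (fdiff f).
Proof. by move=> fA m l mn; rewrite -iterSr -mulrA -exprS fA. Qed.

Lemma dboundWn r n m A f : (m <= n)%N -> dbound r n A f -> dbound r m A f.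
Proof. by move=> mn fA i l im; rewrite fA// (leq_trans im). Qed.

(** Discrete Leibniz rule: differencing a product gives two products, one with a shifted factor.
    Every order doubles the number of terms, whence [2 ^+ n]. *)
Lemma dboundM r n A B f g : 0 <= r -> 0 <= A -> 0 <= B ->
  dbound r n A f -> dbound r n B g -> dbound r n (2 ^+ n * A * B) (f \* g).
Proof.
move=> r0; elim: n A B f g => [|n IHn] A B f g A0 B0 fA gB m l.
  rewrite leqn0 => /eqP->; rewrite /= normrM mul1r expr0 mulr1.
  by have := fA 0%N l isT; have := gB 0%N l isT; rewrite !expr0 !mulr1 => *; apply: ler_pM.
case: m => [_|m mn].
  have := fA 0%N l isT; have := gB 0%N l isT; rewrite /= !expr0 !mulr1 normrM => ? ?.
  apply: (@le_trans _ _ (A * B)); first exact: ler_pM.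
  by rewrite -mulrA ler_peMl ?mulr_ge0// exprn_ege1// ler1n.
have -> : iter m.+1 fdiff (f \* g) l =
    iter m fdiff ((fdiff f \* (fun i => g i.+1)) \+ (f \* fdiff g)) l.
  rewrite iterSr; congr (iter m _ _ l); apply/funext => i; rewrite /fdiff /=; ring.
have h1 : dbound r n (2 ^+ n * (A * r) * B) (fdiff f \* (fun i => g i.+1)).
  apply: IHn; rewrite ?mulr_ge0//; first exact: dbound_fdiff.
  exact/dboundS/(dboundWn (leqnSn n)).
have h2 : dbound r n (2 ^+ n * A * (B * r)) (f \* fdiff g).
  apply: IHn; rewrite ?mulr_ge0//; last exact: dbound_fdiff.
  exact: (dboundWn (leqnSn n)).
have := @dboundD _ _ _ _ _ _ h1 h2 m l mn.
suff -> : (2 ^+ n * (A * r) * B + 2 ^+ n * A * (B * r)) * r ^+ m =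
          2 ^+ n.+1 * A * B * r ^+ m.+1 by [].
by rewrite !exprS; ring.
Qed.

(** The [m]-th difference is [(-1)^m m! / ((l + x) ... (l + m + x))]; this is the ratio of
    consecutive ones, written so that induction needs only ring identities. *)
Lemma iter_fdiff_inv (x : R) m l : 0 < x ->
  (l%:R + x) * iter m.+1 fdiff (fun i => (i%:R + x)^-1) l =
  - m.+1%:R * iter m fdiff (fun i => (i%:R + x)^-1) l.+1.
Proof.
move=> x0; have lx i : i%:R + x != 0 by rewrite gt_eqF// ltr_wpDl.
elim: m l => [|m IHm] l.
  by rewrite /= /fdiff; have := lx l; have := lx l.+1 => ? ?; field; rewrite nat1r; apply/andP.
set w := fun i => _ in IHm *.
have e : (l%:R + x) * iter m.+1 fdiff w l.+1 =
    - m.+1%:R * iter m fdiff w l.+2 - iter m.+1 fdiff w l.+1.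
  by rewrite -IHm; ring.
have -> : iter m.+2 fdiff w l = iter m.+1 fdiff w l.+1 - iter m.+1 fdiff w l by [].
rewrite mulrBr e IHm.
have -> : iter m.+1 fdiff w l.+1 = iter m fdiff w l.+2 - iter m fdiff w l.+1 by [].
ring.
Qed.

Lemma iter_fdiff_inv_le (x r : R) m l : 0 < x -> x^-1 <= r ->
  `|iter m fdiff (fun i => (i%:R + x)^-1) l| <= m`!%:R * r ^+ m.+1.
Proof.
move=> x0 xr; have lx i : 0 < i%:R + x by rewrite ltr_wpDl.
have lxr i : (i%:R + x)^-1 <= r by rewrite (le_trans _ xr)// lef_pV2 ?posrE// lerDr.
have r0 : 0 <= r by rewrite (le_trans _ xr)// invr_ge0 ltW.
have w0 i : 0 <= (i%:R + x)^-1 by rewrite invr_ge0 ltW.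
elim: m l => [|m IHm] l.
  by rewrite /= mul1r expr1 ger0_norm.
have /(canRL (mulKf (lt0r_neq0 (lx l)))) -> := iter_fdiff_inv m l x0.
rewrite normrM normrM normrN normr_nat ger0_norm//.
rewrite factS natrM [r ^+ _]exprS mulrACA mulrA [_ * r]mulrC -!mulrA.
by rewrite ler_pM ?mulr_ge0// ler_wpM2l.
Qed.

Lemma dbound_inv (x r : R) n : 0 < x -> 0 < r -> x^-1 <= 2 * r ->
  dbound r n (n`!%:R * 2 ^+ n.+1 * r) (fun i => (i%:R + x)^-1).
Proof.
move=> x0 r0 xr m l mn; apply: (le_trans (iter_fdiff_inv_le m l x0 xr)).
rewrite -[leRHS]mulrA -exprS -mulrA exprMn.
rewrite ler_pM ?mulr_ge0 ?exprn_ge0 ?ler_nat ?leq_fact// ?(ltW r0)//.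
by rewrite ler_wpM2r ?exprn_ge0 ?(ltW r0)// ler_weXn2l ?ler1n.
Qed.

(** With [N = l + L + 1], the weights [N / (2 (N + a))] and [(N + 2 a) / (2 (N + a))] are [1/2]
    minus and plus [a / (2 (N + a))]. The shift grows to [L.+1] because the forward differences
    start at the left neighbour of [N]. *)
Lemma step_shift a f L l : 0 < a ->
  let g i := f (i + L)%N in
  step a f (l + L.+1) = - 2^-1 * (fdiff (fdiff g) l +
    a * ((l%:R + (L.+1%:R + a))^-1 * (fdiff g l.+1 + fdiff g l))).
Proof.
move=> a0 g; rewrite /step addnS /= /fdiff /g !addSn.
have -> : l%:R + (L.+1%:R + a) = (l + L).+1%:R + a by rewrite addrA -natrD addnS.
have ? : (l + L).+1%:R + a != 0 by rewrite gt_eqF// ltr_wpDl.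
by field; rewrite -natrD nat1r.
Qed.

(** The second difference supplies [r ^+ 2] directly; in the other term one [r] comes from the first
    differences and one from the inverse factor, since [L^-1 <= 2 r]. *)
Lemma dbound_step a n : 0 < a -> exists2 C, 0 <= C &
  forall r L A f, 0 < r -> 0 <= A -> (0 < L)%N -> L%:R^-1 <= 2 * r ->
  dbound r n.+2 A (fun i => f (i + L)%N) ->
  dbound r n (C * (A * r ^+ 2)) (fun i => step a f (i + L.+1)%N).
Proof.
move=> a0; exists (2^-1 * (1 + a * (2 ^+ n * (n`!%:R * 2 ^+ n.+1) * 2))).
  by rewrite mulr_ge0 ?addr_ge0 ?mulr_ge0 ?exprn_ge0 ?ltW.
move=> r L A f r0 A0 L0 Lr fA; set g := fun i => f _ in fA *.
have -> : (fun i => step a f (i + L.+1)%N) = (fun i => - 2^-1 * ((fdiff (fdiff g)) \+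
   (fun j => a * ((fun l => (l%:R + (L.+1%:R + a))^-1) \*
      ((fun l => fdiff g l.+1) \+ fdiff g)) j)) i).
  by apply/funext => l; rewrite step_shift.
have gA : dbound r n (A * r) (fdiff g) by apply: (dboundWn (leqnSn n)); exact: dbound_fdiff.
have Lar : (L.+1%:R + a)^-1 <= 2 * r.
  apply: le_trans Lr; rewrite lef_pV2 ?posrE ?ltr0n// ?addr_gt0//.
  by rewrite -natr1 -addrA lerDl addr_ge0// ltW.
have inv := @dbound_inv (L.+1%:R + a) r n (addr_gt0 (ltr0Sn _ _) a0) r0 Lar.
have ginv := dboundM (ltW r0) _ _ inv (dboundD (dboundS gA) gA).
have := dboundZ (- 2^-1) (dboundD (dbound_fdiff (dbound_fdiff fA)) (dboundZ a (ginv _ _))).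
rewrite normrN !gtr0_norm ?invr_gt0//.
suff -> : forall p q : R, 2^-1 * (A * r * r + a * (p * (q * r) * (A * r + A * r))) =
   2^-1 * (1 + a * (p * q * 2)) * (A * r ^+ 2).
  by apply; rewrite ?mulr_ge0 ?addr_ge0 ?mulr_ge0 ?exprn_ge0// ltW.
by move=> p q; ring.
Qed.

(** [M] steps spend [M.*2] differences and push the start of the controlled range from [L] to
    [L + M]. *)
Lemma dbound_iter_step a M : 0 < a -> exists2 C, 0 <= C &
  forall r L A f, 0 < r -> 0 <= A -> (0 < L)%N -> L%:R^-1 <= 2 * r ->
  dbound r M.*2 A (fun i => f (i + L)%N) ->
  forall l, (L + M <= l)%N -> `|iter M (step a) f l| <= C * (A * r ^+ (2 * M)).
Proof.
move=> a0; elim: M => [|M [C C0 IHM]].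
  exists 1 => // r L A f r0 A0 L0 Lr fA l Ll.
  by have := fA 0%N (l - L)%N isT; rewrite /= subnK ?mul1r//; lia.
have [D D0 stepD] := dbound_step M.*2 a0.
exists (C * D); first exact: mulr_ge0.
move=> r L A f r0 A0 L0 Lr fA l Ll; rewrite iterSr.
have {}fA := stepD r L A f r0 A0 L0 Lr fA.
apply: (le_trans (IHM r L.+1 _ _ r0 _ isT _ fA l _)).
- by rewrite !mulr_ge0 ?exprn_ge0// (ltW r0).
- by apply: le_trans Lr; rewrite lef_pV2 ?posrE ?ltr0n// ler_nat.
- lia.
- by rewrite mulnS exprD -!mulrA.
Qed.

End FiniteDifferences.

(** * Half-line derivatives, unit differences, and a lower bound for [1 - cos theta] *)

Section Derivatives.
Context {R : realType}.
Implicit Types (f : R -> R) (x : R).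

(** Every small [h] satisfies [0 <= x + h] when [x > 0], so the restriction disappears and the
    ordinary derivative is recovered. *)
Lemma diff_quot_ge0_gt0 f x : 0 < x ->
  diff_quot_ge0 f x = (h^-1 *: (f (h *: 1 + x) - f x)) @[h --> 0^'].
Proof.
move=> x0; rewrite /diff_quot_ge0.
have -> : within [set h | 0 <= x + h] 0^' = 0^'.
  apply/seteqP; split => A; rewrite /within/= => nA.
    near=> h; apply: (near nA h) => //=.
    have : `|h| <= x by near: h; exact: dnbhs0_le.
    by rewrite ler_norml => /andP[+ _]; rewrite -subr_ge0 opprK addrC.
  by apply: filterS nA => h Ah _.
suff -> : (fun h => h^-1 * (f (x + h) - f x)) =
  (fun h => h^-1 *: (f (h *: 1 + x) - f x)) by [].
by apply/funext => h; rewrite [h *: 1]mulr1 [h + x]addrC.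
Unshelve. all: by end_near. Qed.

Lemma is_derive_derive_ge0n f n x : smooth_ge0 f -> 0 < x ->
  is_derive x 1 (derive_ge0n n f) (derive_ge0n n.+1 f x).
Proof.
move=> sf x0; have := sf n x (ltW x0).
rewrite /derive_ge0n iterS /derive_ge0 => c.
split; first by move: c; rewrite diff_quot_ge0_gt0.
by rewrite /derive diff_quot_ge0_gt0.
Qed.

Definition rdiff f : R -> R := fun x => f (x + 1) - f x.

Lemma is_derive_iter_rdiff (D : nat -> R -> R) m n :
  (forall n x, 0 < x -> is_derive x 1 (D n) (D n.+1 x)) ->
  forall x, 0 < x -> is_derive x 1 (iter m rdiff (D n)) (iter m rdiff (D n.+1) x).
Proof.
move=> dD; elim: m => [|m IHm] x x0; first exact: dD.
rewrite !iterS /rdiff.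
have d1 : is_derive x 1 (iter m rdiff (D n) \o shift 1) (iter m rdiff (D n.+1) (x + 1)).
  rewrite -[iter m _ _ (x + 1)]mulr1; apply: is_derive1_comp; first exact/IHm/addr_gt0.
  exact: is_derive_shift.
exact: (is_deriveB d1 (IHm x x0)).
Qed.

(** The mean value theorem trades each unit difference for one derivative, since the derivative of
    [iter m rdiff (D n)] is [iter m rdiff (D n.+1)]. *)
Lemma iter_rdiff_le (D : nat -> R -> R) (K : nat -> R) m n x :
  (forall n x, 0 < x -> is_derive x 1 (D n) (D n.+1 x)) ->
  (forall n x, 0 < x -> `|D n x| <= K n) ->
  0 < x -> `|iter m rdiff (D n) x| <= K (m + n)%N.
Proof.
move=> dD DK; elim: m n x => [|m IHm] n x x0; first exact: DK.
rewrite iterS /rdiff.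
have x1 : x < x + 1 by rewrite ltrDl.
have [z||z /[!in_itv]/= /andP[xz _] ->] := MVT x1 (f := iter m rdiff (D n)) (df := iter m rdiff (D n.+1)).
- rewrite in_itv/= => /andP[xz _]; apply: is_derive_iter_rdiff => //.
  exact: lt_trans xz.
- apply: derivable_within_continuous => z; rewrite in_itv/= => /andP[xz _].
  by apply: ex_derive; apply: is_derive_iter_rdiff => //; exact: lt_le_trans xz.
- rewrite addrAC subrr add0r mulr1 addSnnS; apply: IHm; exact: lt_trans xz.
Qed.

(** With [x = theta / 2], [1 - cos theta = 2 sin^2 x]. If [cos x >= 1/2], then
    [sin x >= x cos x >= x / 2]; otherwise [sin^2 x >= 3/4] while [x <= 2]. *)
Lemma one_sub_cos_ge (theta : R) : 0 < theta <= pi -> theta ^+ 2 / 32 <= 1 - cos theta.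
Proof.
move=> /andP[t0 tpi]; pose x := theta / 2.
have x0 : 0 < x by rewrite divr_gt0.
have xpi : x <= pi / 2 by rewrite ler_pM2r.
have pi2 : pi / 2 <= 2 :> R by have [/andP[]] := @pihalf_02_cos_pihalf R.
have -> : theta = x *+ 2 by rewrite /x mulr2n -splitr.
rewrite cos_mulr2n -[x *+ 2]mulr_natr -[_ ^+ 2 *+ 2]mulr_natr.
have cs := cos2Dsin2 x.
have xsin : x * cos x <= sin x.
  have [|z /[!in_itv]/= /andP[z0 zx]] := MVT x0 (fun z _ => is_derive_sin z).
  - by apply: derivable_within_continuous => z _; exact: ex_derive.
  - rewrite sin0 !subr0 => ->; rewrite mulrC ler_wpM2r ?(ltW x0)//.
    have xp : x <= pi by rewrite (le_trans xpi)// ler_pdivrMr// ler_peMr ?pi_ge0 ?ler1n.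
    by rewrite ltW// ltr_cos// in_itv/= ?(ltW z0) ?(ltW x0)//= (le_trans (ltW zx)).
have [c2|c2] := leP (2^-1) (cos x).
  have x2 : 0 <= x / 2 by rewrite divr_ge0 ?(ltW x0).
  have xs : x / 2 <= sin x by apply: le_trans xsin; rewrite ler_pM2l.
  have : (x / 2) ^+ 2 <= sin x ^+ 2 by rewrite lerXn2r ?nnegrE// (le_trans x2).
  by have := sqr_ge0 x; move: cs; rewrite !expr2; lra.
have cos0 : 0 <= cos x.
  by rewrite cos_ge0_pihalf// xpi (le_trans _ (ltW x0))// oppr_le0 divr_ge0 ?pi_ge0.
have : cos x ^+ 2 <= 2^-1 ^+ 2 by rewrite lerXn2r ?nnegrE ?invr_ge0 ?(ltW c2).
have : x ^+ 2 <= 2 ^+ 2 by rewrite lerXn2r ?nnegrE ?(ltW x0)// (le_trans xpi).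
by rewrite !expr2; lra.
Qed.
End Derivatives.

(** * Sampled weights, growth of the scales, and localized Gegenbauer sums *)

Section Kernel.
Context {R : realType}.
Implicit Types (S : nat -> R) (b : nat -> R -> R).

Lemma iter_fdiff_natr (f : R -> R) L m l :
  iter m fdiff (fun i => f (i + L)%:R) l = iter m rdiff f (l + L)%:R.
Proof.
by elim: m l => // m IHm l; rewrite !iterS /fdiff /rdiff !IHm addSn natr1.
Qed.

(** [0 < L] keeps the sample points in the open half-line, where the derivatives are two-sided. *)
Lemma dbound_smooth (f : R -> R) (K : nat -> R) (A r : R) n L :
  smooth_ge0 f -> (0 < L)%N ->
  (forall m u, 0 <= u -> `|derive_ge0n m f u| <= K m * r ^+ m) ->
  0 <= r -> (forall m, (m <= n)%N -> K m <= A) ->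
  dbound r n A (fun i => f (i + L)%:R).
Proof.
move=> sf L0 fK r0 KA m l mn; rewrite iter_fdiff_natr.
have lL : 0 < (l + L)%:R :> R by rewrite ltr0n addn_gt0 L0 orbT.
have := @iter_rdiff_le R (fun i => derive_ge0n i f) (fun i => K i * r ^+ i) m 0 _
  (fun i x => @is_derive_derive_ge0n R f i x sf) (fun i x x0 => fK i x (ltW x0)) lL.
by move=> /le_trans; apply; rewrite addn0 ler_wpM2r ?exprn_ge0 ?KA.
Qed.

Lemma gsum_le k (f : nat -> R) (B theta : R) P n :
  (forall l, (l < P)%N -> f l = 0) -> (forall l, (P <= l)%N -> `|f l| <= B) ->
  (P <= n)%N ->
  `|gsum (Defs.eta k.+2) (cos theta) f n| <=
    B * (n - P)%:R * (n%:R + Defs.eta k.+2) ^+ k.+1.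
Proof.
move=> f0 fB Pn; rewrite /gsum; set a := Defs.eta _.
have a0 : 0 <= a by rewrite /a /Defs.eta -natr1 addrK divr_ge0.
rewrite (big_cat_nat _ Pn)//= big_nat big1 ?add0r; last first.
  by move=> l lP; rewrite f0 ?mul0r.
apply: (le_trans (ler_norm_sum _ _ _)).
apply: (@le_trans _ _ (\sum_(P <= l < n) (B * (n%:R + a) ^+ k.+1))); last first.
  by rewrite sumr_const_nat -[_ *+ _]mulr_natr mulrAC.
apply: ler_sum_nat => l /andP[Pl ln]; rewrite normrM ler_pM ?fB//.
rewrite normrM ger0_norm ?addr_ge0// exprS.
apply: ler_pM; rewrite ?addr_ge0// ?lerD2r ?ler_nat ?(ltnW ln)//.
apply: (le_trans (gegenbauer_le k l theta)).
apply: lerXn2r; rewrite ?nnegrE ?addr_ge0//.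
by rewrite (@le_trans _ _ n%:R) ?ler_nat// lerDl.
Qed.

(** Turns a number of terms of order [y - x], each of size [y ^+ k], into the difference of powers
    of the final bound. *)
Lemma mulrBX_le (x y : R) k : 0 <= x -> x <= y ->
  (y - x) * y ^+ k <= y ^+ k.+1 - x ^+ k.+1.
Proof.
move=> x0 xy; rewrite mulrBl -exprS lerD2l lerN2 exprS ler_wpM2l//.
by rewrite lerXn2r ?nnegrE// (le_trans x0).
Qed.

Lemma scale_ge1 S j : scale_sequence S -> 1 <= S j.
Proof.
move=> hS; rewrite -(scale0 hS); case: j => // j.
exact/ltW/(scale_incr hS).
Qed.

Lemma scale_gap_ge S j : scale_sequence S -> S 1%N - S 0%N <= S j.+1 - S j.
Proof.
by move=> hS; elim: j => // j IHj; apply: (le_trans IHj (scale_gap hS (ltn0Sn j))).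
Qed.

(** The gaps never shrink, so [S] grows at least linearly. *)
Lemma scale_unbounded S (A : R) : scale_sequence S -> \forall j \near \oo, A <= S j.-1.
Proof.
move=> hS; have d0 : 0 < S 1%N - S 0%N by rewrite subr_gt0 (scale_incr hS).
have lin j : j%:R * (S 1%N - S 0%N) <= S j.
  elim: j => [|j IHj]; first by rewrite mul0r (le_trans ler01)// scale_ge1.
  rewrite -natr1 mulrDl mul1r (le_trans (lerD IHj (scale_gap_ge j hS)))//.
  by rewrite addrC subrK.
exists (Num.truncn (A / (S 1%N - S 0%N))).+2 => // -[|j]//= jA.
apply: le_trans (lin j); rewrite -ler_pdivrMr//.
by apply: ltW; apply: lt_le_trans (truncnS_gt _) _; rewrite ler_nat.
Qed.

Lemma weight_eq0 S b j u : weight_functions S b -> (0 < j)%N -> 0 <= u ->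
  (u < S j.-1) || (S j.+1 < u) -> b j u = 0.
Proof.
move=> hb j0 u0 uS; apply/eqP/negPn/negP => bu.
have : supp_ge0 (b j) u by apply: subset_closure.
by move=> /(weight_supp hb j0) /=; rewrite in_itv/=; move: uS; lra.
Qed.

Lemma PsiE d b j (t : R) n : (forall l, (n <= l)%N -> b j l%:R = 0) ->
  Psi d b j t =
  (Defs.eta d * omega d)^-1 * gsum (Defs.eta d) t (fun l => b j l%:R) n.
Proof.
move=> b0; rewrite /Psi; apply/cvg_lim => //.
apply: cvg_near_cst.
exists n => // m /= nm; rewrite /series /gsum mulr_sumr /= (big_cat_nat _ nm)//=.
rewrite [X in _ + X]big_nat [X in _ + X]big1 ?addr0; last first.
  by move=> l /andP[nl _]; rewrite b0 ?mul0r.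
by apply: eq_bigr => l _; rewrite /Z; ring.
Qed.

(** After multiplication by [(1 - cos theta) ^+ M] the sum is bounded by the number of terms times
    their size. The lower bound [gap] on the width absorbs the [2 M] extra indices and the roundings
    into a multiple of [s' - s]. *)
Lemma gsum_localized_le k M (gap : R) : 0 < gap -> exists2 C, 0 <= C &
  forall (f : nat -> R) s s' B theta, 0 < theta <= pi ->
  M%:R <= s -> 1 <= s' -> gap <= s' - s ->
  (forall l, (l%:R < s) || (s' < l%:R) -> f l = 0) ->
  (forall l, s < (l + M).+1%:R ->
    `|iter M (step (Defs.eta k.+2)) f l| <= B) ->
  theta ^+ (2 * M) *
    `|gsum (Defs.eta k.+2) (cos theta) f ((Num.truncn s').+1 + M).+1| <=
  C * (s' ^+ k.+2 - s ^+ k.+2) * B.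
Proof.
move=> gap0; set a : R := Defs.eta k.+2.
have a0 : 0 < a by rewrite /a /Defs.eta -natr1 addrK divr_gt0.
(* [E] serves [Q + M + 2 + a <= E * s'], by [1 <= s']; [c] serves the index count [Q + 2 + 2 M - P],
   at most [s' - s + 2 M + 3], by [gap <= s' - s]. *)
pose E := 3 + M%:R + a; pose c := 1 + (2 * M%:R + 3) / gap.
have E0 : 0 <= E by rewrite !addr_ge0// ltW.
have c0 : 0 <= c.
  by rewrite addr_ge0// divr_ge0 ?(ltW gap0)// addr_ge0// mulr_ge0.
exists (32 ^+ M * (c * E ^+ k.+1)); first by rewrite !mulr_ge0 ?exprn_ge0.
move=> f s s' B theta th Ms s'1 ss' f0 fB.
have s0 : 0 <= s by apply: le_trans Ms.
have ss0 : 0 <= s' - s by rewrite (le_trans (ltW gap0)).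
set Q := Num.truncn s'.
have [Qs sQ] : Q%:R <= s' /\ s' < Q.+1%:R.
  by split; [rewrite truncn_le (le_trans ler01)|exact: truncnS_gt].
have [P Ps sP] : exists2 P : nat, P%:R <= s & s < P.+1%:R.
  by exists (Num.truncn s); [rewrite truncn_le|exact: truncnS_gt].
have PQ : (P <= Q)%N.
  by rewrite -ltnS -(ltr_nat R) (le_lt_trans Ps)// (le_lt_trans _ sQ)// -subr_ge0.
have MP : (M <= P)%N by rewrite -ltnS -(ltr_nat R) (le_lt_trans Ms).
have fQ l : (Q < l)%N -> f l = 0.
  by move=> Ql; apply: f0; rewrite (lt_le_trans sQ) ?orbT// ler_nat.
have fP l : (l < P)%N -> f l = 0.
  by move=> lP; apply: f0; rewrite (lt_le_trans _ Ps)// ltr_nat.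
(* [f] vanishes from [Q.+1] on and the steps add [M] indices; the last [.+1] is there because [gsum]
   excludes its upper limit. *)
clearbody Q; set n := (Q.+1 + M).+1.
have gB : `|gsum a (cos theta) (iter M (step a) f) n| <=
    B * (n - (P - M))%:R * (n%:R + a) ^+ k.+1.
  apply: gsum_le => [l lP|l lP|]; last by rewrite /n; clear -PQ; lia.
  - by apply: (iter_step_low _ fP); clear -lP MP; lia.
  - by apply: fB; rewrite (lt_le_trans sP)// ler_nat; clear -lP MP; lia.
have B0 : 0 <= B.
  by apply: le_trans (fB P _); rewrite ?(lt_le_trans sP)// ler_nat ltnS leq_addr.
have nE : n%:R + a <= E * s'.
  have : 0 <= (2 + M%:R + a) * (s' - 1).
    by rewrite mulr_ge0 ?subr_ge0// !addr_ge0// ltW.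
  have -> : n%:R = Q%:R + M%:R + 2 :> R.
    have -> : n = (Q + M + 2)%N by rewrite /n; clear; lia.
    by rewrite !natrD.
  by move: Qs; rewrite /E; clear; lra.
have cnt : (n - (P - M))%:R <= c * (s' - s).
  have -> : (n - (P - M))%:R = Q%:R + 2 + 2 * M%:R - P%:R :> R.
    have -> : (n - (P - M) = Q + 2 + 2 * M - P)%N by rewrite /n; clear -MP; lia.
    by rewrite natrB ?(natrD, natrM)// -addnA (leq_trans PQ) ?leq_addr.
  have : 2 * M%:R + 3 <= (2 * M%:R + 3) / gap * (s' - s).
    by rewrite -mulrA ler_peMr ?addr_ge0 ?mulr_ge0// mulrC ler_pdivlMr// mul1r.
  by move: Qs sP; rewrite /c mulrDl mul1r -natr1; clear; lra.
have cosM : theta ^+ (2 * M) <= 32 ^+ M * (1 - cos theta) ^+ M.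
  rewrite exprM -exprMn lerXn2r ?nnegrE ?sqr_ge0 ?mulr_ge0 ?subr_ge0 ?cos_le1//.
  by rewrite mulrC -ler_pdivrMr// one_sub_cos_ge.
set X := _ - s ^+ k.+2.
have XE : (s' - s) * s' ^+ k.+1 <= X by apply: mulrBX_le => //; rewrite -subr_ge0.
apply: (@le_trans _ _ (32 ^+ M * `|(1 - cos theta) ^+ M * gsum a (cos theta) f n|)).
  rewrite normrM mulrA ler_wpM2r// (le_trans cosM)// ler_wpM2l ?exprn_ge0//.
  exact: ler_norm.
rewrite -!mulrA ler_wpM2l ?exprn_ge0// (gsum_iter_step (cos theta) a0 fQ (leqnn _)).
apply: (le_trans gB); rewrite -mulrA.
have -> : c * (E ^+ k.+1 * (X * B)) = B * (c * (X * E ^+ k.+1)) by ring.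
apply: ler_wpM2l => //.
apply: (@le_trans _ _ (c * (s' - s) * (E * s') ^+ k.+1)).
  apply: ler_pM => //; first by rewrite exprn_ge0// addr_ge0// ltW.
  by rewrite lerXn2r ?nnegrE ?(le_trans _ nE)// addr_ge0// ltW.
by rewrite -mulrA ler_wpM2l// exprMn mulrCA mulrC ler_wpM2r// exprn_ge0.
Qed.

End Kernel.

(** * The kernel estimate *)

Theorem theorem1p2 (R : realType) (d : nat) (hd : (2 <= d)%N)
    (S : nat -> R) (b : nat -> R -> R)
    (hS : scale_sequence S) (hb : weight_functions S b) :
  forall M : nat, (d < M)%N ->
  exists C : R, 0 < C /\
    \forall j \near \oo, forall theta : R, 0 < theta <= pi ->
      `|Psi d b j (cos theta)| <=
        C * (S j.+1 ^+ d - S j.-1 ^+ d) *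
        Num.max (1 / (S j.-1 ^+ (2 * M) * theta ^+ (2 * M)))
                (1 / ((S j - S j.-1) ^+ (2 * M) * theta ^+ (2 * M))).
Proof.
case: d hd => [|[|k]]// _ M _.
set a : R := Defs.eta k.+2.
have a0 : 0 < a by rewrite /a /Defs.eta -natr1 addrK divr_gt0.
have [D D0 iterD] := dbound_iter_step M a0.
have [K bK] := choice (weight_derive hb).
pose A := \sum_(i < M.*2.+1) `|K i|.
have KA m : (m <= M.*2)%N -> `|K m| <= A.
  move=> mM; rewrite /A (bigD1 (Ordinal (mM : (m < M.*2.+1)%N)))//=.
  by rewrite lerDl sumr_ge0.
have A0 : 0 <= A by rewrite sumr_ge0.
have gap0 : 0 < S 1%N - S 0%N by rewrite subr_gt0 (scale_incr hS).
have [C C0 gsumC] := gsum_localized_le k M gap0.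
pose c := `|(a * omega k.+2)^-1| * C * D * A.
have c0 : 0 <= c by rewrite !mulr_ge0.
exists (c + 1); split; first by rewrite ltr_wpDl.
near=> j => theta th.
have j0 : (0 < j)%N by near: j; exists 1%N.
(* Ensures [P - 2 M > s - 1 - 2 M >= s / 2], hence [L^-1 <= 2 * r] below. *)
have SM : 4 * M%:R + 2 <= S j.-1 by near: j; exact: scale_unbounded.
set s := S j.-1 in SM *; set s' := S j.+1; set del := S j - s.
have ss' : S 1%N - S 0%N <= s' - s.
  rewrite (le_trans (scale_gap_ge j hS))// lerD2l lerN2.
  by apply/ltW/(scale_incr hS); clear -j0; lia.
have s'1 : 1 <= s' by exact: scale_ge1.
have s1 : 1 <= s by exact: scale_ge1.
have s0 : 0 < s by apply: lt_le_trans s1.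
have del0 : 0 < del by rewrite subr_gt0; apply: (scale_incr hS); clear -j0; lia.
pose r := Num.max s^-1 del^-1.
have r0 : 0 < r by rewrite lt_max invr_gt0 s0.
have [P Ps sP] : exists2 P : nat, P%:R <= s & s < P.+1%:R.
  by exists (Num.truncn s); [rewrite truncn_le ltW|exact: truncnS_gt].
have PM : (4 * M < P)%N.
  rewrite -ltnS -(ltr_nat R) (le_lt_trans _ sP)// (le_trans _ SM)//.
  by rewrite -natr1 natrM; clear; lra.
pose f l := b j l%:R.
have f0 l : (l%:R < s) || (s' < l%:R) -> f l = 0 by exact: (weight_eq0 hb j0).
(* The [M] steps spread the support left to [P - M], and control starts at [L + M]: this [L] makes
   the two agree. *)
pose L := (P - 2 * M)%N.
have L0 : (0 < L)%N by rewrite /L; clear -PM; lia.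
have Lr : L%:R^-1 <= 2 * r.
  apply: (@le_trans _ _ (2 * s^-1)); last by rewrite ler_wpM2l// le_max lexx.
  rewrite -[2 * _]invrK invfM invrK lef_pV2 ?posrE ?ltr0n ?mulr_gt0//.
  rewrite /L natrB ?natrM; last by clear -PM; lia.
  by move: sP SM; rewrite -natr1; clear; lra.
have fA : dbound r M.*2 A (fun i => f (i + L)%N).
  apply: (dbound_smooth (K := fun i => `|K i|)) => //.
  - exact: (weight_smooth hb).
  - move=> m u u0; apply: (le_trans (bK m j u j0 u0)).
    rewrite -/s -/del -exprVn; apply: (@le_trans _ _ (`|K m| * del^-1 ^+ m)).
      by rewrite ler_wpM2r ?exprn_ge0 ?invr_ge0 ?(ltW del0)// ler_norm.
    rewrite ler_wpM2l// lerXn2r ?nnegrE ?invr_ge0 ?(ltW del0) ?(ltW r0)//.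
    by rewrite le_max lexx orbT.
  - exact: ltW.
have iterB l : s < (l + M).+1%:R ->
    `|iter M (step a) f l| <= D * (A * r ^+ (2 * M)).
  move=> sl; apply: (iterD r L A f r0 A0 L0 Lr fA l).
  have : (P < (l + M).+1)%N by rewrite -(ltr_nat R) (le_lt_trans Ps).
  by rewrite /L; clear -PM; lia.
have Ms : M%:R <= s by have : 0 <= M%:R :> R by []; move: SM; clear; lra.
have := gsumC f s s' _ theta th Ms s'1 ss' f0 iterB.
set n := (_ + M).+1 => gsumB.
have fn l : (n <= l)%N -> b j l%:R = 0.
  move=> nl; apply: f0; apply/orP; right; rewrite (lt_le_trans (truncnS_gt _))//.
  by rewrite ler_nat (leq_trans _ nl)// leqW// leq_addr.
rewrite (PsiE _ _ fn) -/a normrM.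
set X := s' ^+ k.+2 - s ^+ k.+2 in gsumB *.
have X0 : 0 <= X.
  rewrite subr_ge0 lerXn2r ?nnegrE ?(ltW s0) ?(le_trans ler01 s'1)//.
  by rewrite -subr_ge0 (le_trans (ltW gap0)).
have t0 : 0 < theta ^+ (2 * M) by rewrite exprn_gt0//; case/andP: th.
apply: (@le_trans _ _ (c * X * (r ^+ (2 * M) / theta ^+ (2 * M)))).
  move: gsumB; rewrite mulrC -ler_pdivlMr// => gsumB.
  apply: (le_trans (ler_wpM2l (normr_ge0 _) gsumB)).
  by rewrite le_eqVlt; apply/orP; left; apply/eqP; rewrite /c; ring.
apply: ler_pM; rewrite ?mulr_ge0 ?exprn_ge0 ?invr_ge0 ?(ltW t0) ?(ltW r0)//.
  by rewrite ler_wpM2r// lerDl.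
rewrite !div1r !invfM -!exprVn /r; case: (leP s^-1 del^-1) => _.
  by rewrite le_max lexx orbT.
by rewrite le_max lexx.
Unshelve. all: by end_near. Qed.
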